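(* Let $K$ be a field, and let $I\subset R=K[x_1,\dots,x_n]$ and $J\subset T=K[y_1,\dots,y_m]$ be proper homogeneous ideals. Let $S=R\otimes_K T=K[x_1,\dots,x_n,y_1,\dots,y_m]$, and denote the extended ideals $IS$ and $JS$ again by $I$ and $J$. Then: (a) For all $k\ge1$ and all $\mathfrak{p}\in\operatorname{Ass}(I^k)$, we have $\mathrm{v}_{\mathfrak{p}}((IJ)^k)=\mathrm{v}_{\mathfrak{p}}(I^k)+\alpha(J)k$. (b) For all $k\ge1$ and all $\mathfrak{q}\in\operatorname{Ass}(J^k)$, we have $\mathrm{v}_{\mathfrak{q}}((IJ)^k)=\mathrm{v}_{\mathfrak{q}}(J^k)+\alpha(I)k$.
   Context: Polynomial rings are standard graded. For an ideal $L$ of a polynomial ring $S$, $\operatorname{Ass}(L)$ denotes the set of associated primes of $S/L$. Ideals (and primes) of $R$ and of $T$ are identified with their extensions to $S$; under this identification $\operatorname{Ass}(L)=\operatorname{Ass}(LS)$. For a graded ideal $L$ and $\mathfrak{p}\in\operatorname{Ass}(L)$, the $\mathrm{v}_{\mathfrak{p}}$-number $\mathrm{v}_{\mathfrak{p}}(L)$ is the least degree of a homogeneous polynomial $f$ such that $(L:f)=\mathfrak{p}$. For a graded ideal $L$, $\alpha(L)=\min\{d:(L/\mathfrak{m}L)_d\neq0\}$ is its initial degree, where $\mathfrak{m}$ is the graded maximal ideal.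
   Formalization: The ideals I and J are also assumed nonzero: for I = 0 and J nonzero, (a) would read 0 = 0 + α(J)k, which is false because α(J) ≥ 1, (b) fails symmetrically for J = 0, and the initial degree α of the zero ideal is undefined. *)

(* Defs.v *)
From mathcomp Require Export all_boot all_order all_algebra.
From mathcomp Require Export boolp classical_sets.
From mathcomp Require Export mpoly.

Set Implicit Arguments.
Unset Strict Implicit.
Unset Printing Implicit Defensive.

Import GRing.Theory.
Local Open Scope ring_scope.
Local Open Scope classical_set_scope.

(* Ideals are [set]s rather than the [idealr] of ring_quotient because the   *)
(* latter are always proper, while colon ideals, products and the power 0    *)
(* may be the whole ring.                                                    *)
Section Ideals.
Variable A : comNzRingType.
Implicit Types (I J L p X : set A) (f : A) (k : nat).

Definition ideal I : Prop :=
  [/\ I 0, (forall x y, I x -> I y -> I (x + y))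
    & (forall a x, I x -> I (a * x))].

Definition ideal_gen X : set A := smallest ideal X.

Definition ideal_mul I J : set A :=
  ideal_gen [set z | exists x y, [/\ I x, J y & z = x * y]].

Definition ideal_exp I k : set A := iter k (ideal_mul I) setT.

Definition colon L f : set A := [set g | L (g * f)].

Definition prime_ideal p : Prop :=
  [/\ ideal p, ~ p 1 & forall x y, p (x * y) -> p x \/ p y].

(* (L : f) is the annihilator of the class of f in A / L. *)
Definition Ass L : set (set A) :=
  [set p | prime_ideal p /\ exists f, colon L f = p].

End Ideals.

Definition ideal_ext (A B : comNzRingType) (phi : A -> B) (I : set A) : set B :=
  ideal_gen (phi @` I).

(* The value on the empty set is the junk value 0. *)
Definition least (D : set nat) : nat :=
  xget 0%N [set d | D d /\ forall e, D e -> (d <= e)%N].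

Section Graded.
Variables (K : fieldType) (n : nat).
Implicit Types (L p : set {mpoly K[n]}).

Definition homogeneous_ideal L : Prop :=
  ideal L /\ forall d f, L f -> L (pihomog mdeg d f).

Definition graded_max_ideal : set {mpoly K[n]} :=
  ideal_gen (range (fun i : 'I_n => 'X_i)).

(* No f = 0 problem: (L : 0) is the whole ring, hence never a prime p. *)
Definition vnumber p L : nat :=
  least [set d | exists f, f \is d.-homog /\ colon L f = p].

(* (L / mL)_d <> 0 means that some form of degree d lies in L but not in mL. *)
Definition alpha L : nat :=
  least [set d | exists f,
    [/\ f \is d.-homog, L f & ~ ideal_mul graded_max_ideal L f]].

End Graded.

(* K[x_1..x_n] (x) K[y_1..y_m] is {mpoly K[n + m]}: the x_i are the first n  *)
(* variables and the y_j the last m ones.                                    *)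
Definition inclR (K : fieldType) (n m : nat) :
    {mpoly K[n]} -> {mpoly K[n + m]} :=
  comp_mpoly [tuple 'X_(lshift m i) | i < n].

Definition inclT (K : fieldType) (n m : nat) :
    {mpoly K[m]} -> {mpoly K[n + m]} :=
  comp_mpoly [tuple 'X_(rshift n j) | j < m].

(* Main.v *)
(**
Write A = I^k and B = J^k, so that AB is contained in (IJ)^k and (IJ)^k in both
A and B. The ideal A is generated by polynomials in the x_i, hence every nonzero
polynomial in the y_j is a nonzerodivisor modulo A; symmetrically for B.

If (A : f) = p with f homogeneous, pick h in J of degree alpha(J) in the y_j:
then ((IJ)^k : f h^k) = p, because h^k is not in p.

Conversely let ((IJ)^k : g) = p with g homogeneous of degree e. Multiplying by
h^k gives (A : g) = p, and a nonzero element of A in the x_i, which lies in p,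
gives g in B; so all monomials of g have y-degree at least alpha(J) k. As A is
homogeneous for each y_j-degree and p is prime, g can be replaced successively
by one of its homogeneous components for each of these gradings. It then has the
form y^c s with |c| >= alpha(J) k, and (A : s) = p with s of degree e - |c|.
*)

From HB Require Import structures.
Require Import Defs.

Set Implicit Arguments.
Unset Strict Implicit.
Unset Printing Implicit Defensive.

Import GRing.Theory.
Local Open Scope ring_scope.
Local Open Scope classical_set_scope.

(** * Ideals, their products and powers, and colon ideals *)

Section IdealTheory.
Variable A : comNzRingType.
Implicit Types (I J L p Q G H : set A) (x y : A).

Lemma ideal0 L : ideal L -> L 0.
Proof. by case. Qed.

Lemma idealD L x y : ideal L -> L x -> L y -> L (x + y).
Proof. by case=> _ LD _; exact: LD. Qed.

Lemma idealMl L a x : ideal L -> L x -> L (a * x).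
Proof. by case=> _ _ LM; exact: LM. Qed.

Lemma idealMr L a x : ideal L -> L x -> L (x * a).
Proof. by move=> idL Lx; rewrite mulrC; exact: idealMl. Qed.

Lemma idealB L x y : ideal L -> L x -> L y -> L (x - y).
Proof. by move=> idL Lx Ly; apply: idealD => //; rewrite -mulN1r; exact: idealMl. Qed.

Lemma ideal_sum L (T : Type) (r : seq T) (P : pred T) (F : T -> A) :
  ideal L -> (forall i, P i -> L (F i)) -> L (\sum_(i <- r | P i) F i).
Proof.
by move=> idL LF; apply: (big_ind L) => //; [apply: ideal0|move=> *; apply: idealD].
Qed.

Lemma idealT : ideal [set: A].
Proof. by []. Qed.

Lemma ideal_colon L x : ideal L -> ideal (colon L x).
Proof.
move=> idL; split=> [|a b|a b]; rewrite /colon /= ?mul0r ?mulrDl -?mulrA.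
- exact: ideal0.
- exact: idealD.
- exact: idealMl.
Qed.

Lemma ideal_genP G : ideal (ideal_gen G).
Proof.
split=> [|x y Gx Gy|a x Gx] Q [idQ GQ].
- exact: ideal0.
- by apply: idealD => //; [apply: Gx|apply: Gy].
- by apply: idealMl => //; apply: Gx.
Qed.

Lemma sub_ideal_gen G : G `<=` ideal_gen G.
Proof. exact: sub_gen_smallest. Qed.

Lemma ideal_gen_sub G L : ideal L -> G `<=` L -> ideal_gen G `<=` L.
Proof. exact: smallest_sub. Qed.

(** For fixed y it suffices that the ideal (Q : y) contains G; for a fixed x in G, that (Q : x)
    contains H. *)
Lemma ideal_gen_mul_sub G H Q : ideal Q ->
    (forall x y, G x -> H y -> Q (x * y)) ->
  forall x y, ideal_gen G x -> ideal_gen H y -> Q (x * y).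
Proof.
move=> idQ GHQ x y Gx Hy; apply: (@ideal_gen_sub G (colon Q y)) Gx.
  exact: ideal_colon.
move=> {}x Gx; rewrite /colon /= mulrC.
apply: (@ideal_gen_sub H (colon Q x)) Hy; first exact: ideal_colon.
by move=> {}y Hy; rewrite /colon /= mulrC; exact: GHQ.
Qed.

Lemma ideal_mulP I J : ideal (ideal_mul I J).
Proof. exact: ideal_genP. Qed.

Lemma mem_ideal_mul I J x y : I x -> J y -> ideal_mul I J (x * y).
Proof. by move=> Ix Jy; apply: sub_ideal_gen; exists x, y. Qed.

Lemma ideal_mul_sub I J Q : ideal Q -> (forall x y, I x -> J y -> Q (x * y)) ->
  ideal_mul I J `<=` Q.
Proof.
by move=> idQ IJQ; apply: ideal_gen_sub => // z [x [y [Ix Jy ->]]]; exact: IJQ.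
Qed.

Lemma ideal_mulS I I' J J' : I `<=` I' -> J `<=` J' ->
  ideal_mul I J `<=` ideal_mul I' J'.
Proof.
move=> sI sJ; apply: ideal_mul_sub => [|x y Ix Jy]; first exact: ideal_mulP.
by apply: mem_ideal_mul; [apply: sI|apply: sJ].
Qed.

Lemma ideal_mul_subl I J : ideal I -> ideal_mul I J `<=` I.
Proof. by move=> idI; apply: ideal_mul_sub => // x y Ix _; exact: idealMr. Qed.

Lemma ideal_mul_subr I J : ideal J -> ideal_mul I J `<=` J.
Proof. by move=> idJ; apply: ideal_mul_sub => // x y _; exact: idealMl. Qed.

Lemma ideal_mulC I J : ideal_mul I J = ideal_mul J I.
Proof.
apply/seteqP; split; apply: ideal_mul_sub => [|x y xI yJ]; try exact: ideal_mulP.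
all: by rewrite mulrC; exact: mem_ideal_mul.
Qed.

Lemma ideal_expP I k : ideal (ideal_exp I k).
Proof. by case: k => [|k]; [exact: idealT|exact: ideal_mulP]. Qed.

Lemma ideal_expS I J k : I `<=` J -> ideal_exp I k `<=` ideal_exp J k.
Proof. by move=> sIJ; elim: k => [|k IHk] //; exact: ideal_mulS. Qed.

Lemma mem_ideal_exp I x k : I x -> ideal_exp I k (x ^+ k).
Proof.
by move=> Ix; elim: k => [|k IHk] //; rewrite exprS; exact: mem_ideal_mul.
Qed.

Lemma mem_ideal_exp_mul I J k x y : ideal_exp I k x -> ideal_exp J k y ->
  ideal_exp (ideal_mul I J) k (x * y).
Proof.
elim: k x y => [|k IHk] x y //; apply: ideal_gen_mul_sub; first exact: ideal_mulP.
move=> _ _ [u [a [Iu Ia ->]]] [v [b [Jv Jb ->]]].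
by rewrite mulrACA; apply: mem_ideal_mul; [exact: mem_ideal_mul|exact: IHk].
Qed.

Lemma prime_expr p x r : prime_ideal p -> p (x ^+ r) -> p x.
Proof.
case=> _ p1 pM; elim: r => [|r IHr]; first by rewrite expr0.
by rewrite exprS => /pM[|/IHr].
Qed.

End IdealTheory.

(** * Gradings by a weight on monomials *)

Section Gradings.
Variables (K : fieldType) (N : nat) (mf : measure N).
Local Notation S := {mpoly K[N]}.
Implicit Types (L p : set S) (f g a u : S) (d e : nat).

(* [homogeneous_ideal] is the case mf = mdeg. *)
Definition graded L : Prop :=
  ideal L /\ forall d f, L f -> L (pihomog mf d f).

Lemma mcoeff_pihomog d f m :
  (pihomog mf d f)@_m = if mf m == d then f@_m else 0.
Proof.
rewrite [in RHS](mpolyE f) pihomogE !raddf_sum /= big_mkcond /=.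
transitivity (\sum_(i <- msupp f) if mf m == d then f@_i * (i == m)%:R else 0).
  apply: eq_bigr => i _; case: (eqVneq i m) => [->|neq_im].
    by case: ifP => _; rewrite ?mcoeffZ ?mcoeffX ?eqxx.
  by rewrite mulr0 if_same; case: ifP; rewrite // mcoeffZ mcoeffX (negPf neq_im) mulr0.
case: ifP => _; last by rewrite big1.
by apply: eq_bigr => i _; rewrite mcoeffZ mcoeffX.
Qed.

Lemma pihomogM i d u f : u \is i.-homog for mf ->
  pihomog mf d (u * f) = if (i <= d)%N then u * pihomog mf (d - i) f else 0.
Proof.
(* The bound exceeds d, so that the index d - i occurs in the sum. *)
move=> homu; pose k := maxn (mmeasure mf f) d.+1.
rewrite [in LHS](pihomog_partitionE (leq_maxl _ d.+1 : (_ <= k)%N)).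
rewrite mulr_sumr raddf_sum /=.
have homuf j : u * pihomog mf j f \is (i + j).-homog for mf.
  by apply: dhomogM => //; exact: pihomogP.
case: leqP => [le_id|lt_di]; last first.
  rewrite big1 // => j _; apply: pihomog_ne0 (homuf j).
  by rewrite neq_ltn (leq_trans lt_di) ?leq_addr ?orbT.
have lt_k : (d - i < k)%N by rewrite (leq_ltn_trans (leq_subr _ _)) // leq_maxr.
rewrite (bigD1 (Ordinal lt_k)) //= big1 ?addr0 => [|j neq_j].
  by have := homuf (d - i)%N; rewrite subnKC // => /pihomog_dE.
apply: pihomog_ne0 (homuf j); apply: contra neq_j => /eqP dE.
by apply/eqP/val_inj; rewrite /= -dE addKn.
Qed.

(** [mmeasure] is one more than the largest weight in the support, and 0 for the zero polynomial; a
    bound by d thus puts all weights below d. *)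
Lemma pihomog_ge d f : (mmeasure mf f <= d)%N -> pihomog mf d f = 0.
Proof.
move=> le_d; apply/mpolyP => m; rewrite mcoeff_pihomog mcoeff0.
case: eqP => // mE; apply: memN_msupp_eq0; apply: (@mmeasure_mnm_ge _ _ mf).
by rewrite mE.
Qed.

Lemma mmeasureBtop d f : (mmeasure mf f <= d.+1)%N ->
  (mmeasure mf (f - pihomog mf d f) <= d)%N.
Proof.
move=> le_d; apply/bigmax_leqP_seq => m; rewrite mcoeff_msupp => nz_m _.
move: nz_m; rewrite mcoeffB mcoeff_pihomog.
case: (mf m =P d) => [_|neq_d]; first by rewrite subrr eqxx.
rewrite subr0 -mcoeff_msupp => /mmeasure_mnm_lt/leq_trans/(_ le_d).
by rewrite ltnS leq_eqVlt => /predU1P[/neq_d|].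
Qed.

(** A component of a below weight d would need a partner of weight above e in f. *)
Lemma pihomog_top_mul d e a f :
    (mmeasure mf a <= d.+1)%N -> (mmeasure mf f <= e.+1)%N ->
  pihomog mf (d + e) (a * f) = pihomog mf d a * pihomog mf e f.
Proof.
move=> le_a le_f; rewrite [in LHS](pihomog_partitionE le_a) mulr_suml raddf_sum /=.
rewrite big_ord_recr /= big1 ?add0r => [|i _];
  rewrite (pihomogM _ _ (pihomogP _ _ _)).
  by rewrite leq_addr addKn.
case: ifP => // le_i; rewrite (@pihomog_ge _ f) ?mulr0 // (leq_trans le_f) //.
by rewrite ltn_subRL ltn_add2r.
Qed.

(* The induction strips the top component of f and passes to the colon ideal
   (L : t), where t is the top component of a. *)
Lemma graded_top_mul L d a f : graded L -> (mmeasure mf a <= d.+1)%N ->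
  L (a * f) -> exists r, L (pihomog mf d a ^+ r * f).
Proof.
move=> + le_a; move: {2}(mmeasure mf f) (leqnn (mmeasure mf f)) => e.
elim: e L f => [|e IHe] L f le_f grL Laf.
  exists 0%N; rewrite (_ : f = 0) ?mulr0; first exact: ideal0 grL.1.
  by apply/eqP; rewrite -(mmeasure_poly_eq0 mf) -leqn0.
set t := pihomog mf d a; set f' := f - pihomog mf e f.
have Ltf : L (t * pihomog mf e f) by rewrite -pihomog_top_mul //; exact: grL.2.
have grL' : graded (colon L t).
  split=> [|i g]; first exact: ideal_colon grL.1.
  rewrite /colon /= ![_ * t]mulrC => /(grL.2 (d + i)%N).
  by rewrite (pihomogM _ _ (pihomogP _ _ _)) leq_addr addKn.
have [|r] := IHe (colon L t) f' (mmeasureBtop le_f) grL'.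
  rewrite /colon /= /f' mulrBr mulrBl; apply: idealB; first exact: grL.1.
    exact: idealMr grL.1 Laf.
  by rewrite -mulrA; apply: idealMl grL.1 _; rewrite mulrC.
(* Lying in (L : t) costs one more factor t, whence [r.+1]. *)
rewrite /colon /= -/t => Lr; exists r.+1.
rewrite -[f](subrK (pihomog mf e f)) -/f' mulrDr; apply: idealD; first exact: grL.1.
  by rewrite exprSr -mulrA [t * _]mulrC mulrA.
by rewrite exprSr -mulrA; exact: idealMl grL.1 Ltf.
Qed.

(** If a lies in p and t is its top component, [graded_top_mul] puts a power of t in p, hence t
    itself; subtract t and induct. *)
Lemma graded_prime_colon L p f : graded L -> prime_ideal p -> colon L f = p ->
  graded p.
Proof.
move=> grL prp pE; split=> [|i a]; first by case: prp.
have idp : ideal p by case: prp.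
move: {2}(mmeasure mf a) (leqnn (mmeasure mf a)) => d.
elim: d a => [|d IHd] a le_a pa.
  by rewrite pihomog_ge ?(leq_trans le_a) //; exact: ideal0.
have pt : p (pihomog mf d a).
  have [|r Lr] := @graded_top_mul L d a f grL le_a; first by rewrite -pE in pa.
  by apply: (@prime_expr _ p _ r prp); rewrite -pE.
rewrite -[a](subrK (pihomog mf d a)) raddfD /=; apply: idealD => //.
  by apply: IHd (mmeasureBtop le_a) _; exact: idealB.
have [->|neq_id] := eqVneq i d; first by rewrite pihomog_id.
by rewrite (@pihomog_ne0 _ _ _ d) ?pihomogP // 1?eq_sym //; exact: ideal0.
Qed.

(** As p is graded, it kills every component of f modulo L. If every annihilator were larger,
    elements b_e outside p with b_e f_e in L would have a product killing f, hence lying in the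
    prime p. *)
Lemma graded_prime_component L p f : graded L -> prime_ideal p ->
  colon L f = p -> exists e, colon L (pihomog mf e f) = p.
Proof.
move=> grL prp pE; have grp := graded_prime_colon grL prp pE.
have sub_p e a : p a -> L (a * pihomog mf e f).
  move=> pa; rewrite [a](pihomog_partitionE (leqnn (mmeasure mf a))) mulr_suml.
  apply: ideal_sum grL.1 _ => i _.
  have : L (pihomog mf i a * f) by have := grp.2 i a pa; rewrite -{1}pE.
  move/(grL.2 (i + e)%N); rewrite (pihomogM _ _ (pihomogP _ _ _)).
  by rewrite leq_addr addKn.
apply: contrapT => noe.
have wit e : exists b, L (b * pihomog mf e f) /\ ~ p b.
  apply: contrapT => nob; apply: noe; exists e.
  apply/seteqP; split=> b; last exact: sub_p.
  by move=> Lb; apply: contrapT => npb; apply: nob; exists b.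
have [b bP] := choice wit.
have npprod k : ~ p (\prod_(i < k) b i).
  case: prp => _ p1 pM; elim: k => [|k IHk]; first by rewrite big_ord0.
  by rewrite big_ord_recr /= => /pM[|/(bP k).2].
have [k fE] : exists k, f = \sum_(i < k) pihomog mf i f.
  by exists (mmeasure mf f); exact: pihomog_partitionE.
apply: (npprod k); rewrite -pE /colon /= fE mulr_sumr.
apply: ideal_sum grL.1 _ => i _; rewrite (bigD1 i) //= [b i * _]mulrC -mulrA.
exact: idealMl grL.1 (bP i).1.
Qed.

Lemma pihomog_mul_in L a f d : ideal L ->
    (forall i j, L (pihomog mf i a * pihomog mf j f)) ->
  L (pihomog mf d (a * f)).
Proof.
move=> idL Laf; rewrite [a](pihomog_partitionE (leqnn (mmeasure mf a))).
rewrite mulr_suml raddf_sum; apply: ideal_sum => // j _.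
rewrite /= (pihomogM _ _ (pihomogP _ _ _)); case: ifP => // _; exact: ideal0.
Qed.

Lemma graded_gen (G : set S) :
    (forall d g, G g -> ideal_gen G (pihomog mf d g)) -> graded (ideal_gen G).
Proof.
move=> grG; split=> [|d f Gf]; first exact: ideal_genP.
(* The polynomials with all components in the ideal form an ideal themselves, and it contains G. *)
pose Q := [set f | forall d, ideal_gen G (pihomog mf d f)].
have idG := ideal_genP G.
suff: Q f by exact.
apply: (@ideal_gen_sub _ G) Gf => [|g Gg i]; last exact: grG.
split=> [i|x y Qx Qy i|a x Qx i]; rewrite ?raddf0 ?raddfD /=.
- exact: ideal0 idG.
- exact: idealD idG (Qx i) (Qy i).
apply: (@pihomog_mul_in (ideal_gen G) a x i idG) => j l; exact: idealMl idG (Qx l).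
Qed.

Lemma graded_mul I J : graded I -> graded J -> graded (ideal_mul I J).
Proof.
move=> grI grJ; apply: graded_gen => d _ [x [y [Ix Jy ->]]].
apply: pihomog_mul_in => [|i j]; first exact: ideal_mulP.
by apply: mem_ideal_mul; [exact: grI.2|exact: grJ.2].
Qed.

Lemma graded_exp I k : graded I -> graded (ideal_exp I k).
Proof.
by move=> grI; elim: k => [|k IHk]; [split|exact: graded_mul].
Qed.

End Gradings.

(** * Ideals extended from a subset of the variables *)

Section Supports.
Variables (K : fieldType) (N : nat).
Local Notation S := {mpoly K[N]}.
Implicit Types (I J L p : set S) (a f g u : S) (P Q : pred 'I_N).

(** One family of weights serves both uses: [pred1 j] gives the exponent of a single variable, a
    block of variables its share of the total degree. *)
Definition partial_deg P (m : 'X_{1..N}) : nat := \sum_(i | P i) m i.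

Lemma partial_deg0 P : partial_deg P 0%MM = 0%N.
Proof. by rewrite /partial_deg big1 // => i _; rewrite mnm0E. Qed.

Lemma partial_degD P :
  {morph partial_deg P : m1 m2 / (m1 + m2)%MM >-> (m1 + m2)%N}.
Proof.
by move=> m1 m2; rewrite /partial_deg -big_split; apply: eq_bigr => i _; rewrite mnmDE.
Qed.

HB.instance Definition _ P :=
  isMeasure.Build N (partial_deg P) (partial_deg0 P) (partial_degD P).

Lemma partial_deg1 j m : partial_deg (pred1 j) m = m j.
Proof. exact: big_pred1_eq. Qed.

Lemma partial_deg_le P m : (partial_deg P m <= mdeg m)%N.
Proof. by rewrite mdegE [X in (_ <= X)%N](bigID P) /= leq_addr. Qed.

(* Polynomials in the variables satisfying P. *)
Definition supported P f : Prop := f \is 0.-homog for (partial_deg (predC P)).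

Lemma supportedP P f :
  supported P f <-> {in msupp f, forall (m : 'X_{1..N}) i, ~~ P i -> m i = 0%N}.
Proof.
split=> [/dhomogP suppf m /suppf|suppf].
  by move/eqP; rewrite sum_nat_eq0 => /forall_inP m0 i nPi; exact/eqP/m0.
apply/dhomogP => m mf; apply/eqP; rewrite sum_nat_eq0.
by apply/forall_inP => i nPi; rewrite (suppf m).
Qed.

Lemma supported_sub P f g : {subset msupp f <= msupp g} ->
  supported P g -> supported P f.
Proof. by move=> sub /supportedP sg; apply/supportedP => m /sub/sg. Qed.

Lemma supported_deg1 P f j : supported P f -> ~~ P j ->
  f \is 0.-homog for (partial_deg (pred1 j)).
Proof.
by move=> /supportedP sf nPj; apply/dhomogP => m /sf m0; rewrite /= partial_deg1 m0.
Qed.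

Lemma msupp_pihomog (mf : measure N) d f :
  {subset msupp (pihomog mf d f) <= msupp f}.
Proof.
move=> m; rewrite !mcoeff_msupp mcoeff_pihomog; apply: contraNneq => ->.
by rewrite if_same.
Qed.

(** For an ideal, this means being extended from the subring in the variables of P; the reverse
    inclusion then always holds. *)
Definition extended P L : Prop := L `<=` ideal_gen (L `&` [set f | supported P f]).

Lemma extendedE P L : ideal L -> extended P L ->
  L = ideal_gen (L `&` [set f | supported P f]).
Proof.
by move=> idL extL; apply/seteqP; split=> //; apply: ideal_gen_sub => // f [].
Qed.

Lemma extended_mul P I J : ideal I -> ideal J -> extended P I -> extended P J ->
  extended P (ideal_mul I J).
Proof.
move=> idI idJ extI extJ; apply: ideal_mul_sub => [|x y /extI Ix /extJ Jy].
  exact: ideal_genP.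
move: x y Ix Jy; apply: ideal_gen_mul_sub; first exact: ideal_genP.
move=> x y [Ix sx] [Jy sy]; apply: sub_ideal_gen.
by split; [exact: mem_ideal_mul|exact: dhomogM sx sy].
Qed.

Lemma extended_exp P I k : ideal I -> extended P I -> extended P (ideal_exp I k).
Proof.
move=> idI extI; elim: k => [|k IHk] /=; last first.
  by apply: extended_mul => //; exact: ideal_expP.
(* Power 0 is the whole ring, generated by 1, which involves no variable. *)
move=> f _; rewrite -[f]mulr1; apply: (@idealMl _ _ f 1 (ideal_genP _)).
by apply: sub_ideal_gen; split=> //; exact: dhomog1.
Qed.

(** Supported generators are free of the variable j, hence forms of degree 0 for its grading. *)
Lemma extended_graded P L j : ideal L -> extended P L -> ~~ P j ->
  graded (partial_deg (pred1 j)) L.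
Proof.
move=> idL extL nPj; rewrite (extendedE idL extL); apply: graded_gen => d g Gg.
have [_ /supported_deg1/(_ nPj) hg] := Gg.
have [->|neq_d0] := eqVneq d 0%N; first by rewrite pihomog_dE //; exact: sub_ideal_gen.
by rewrite (@pihomog_ne0 _ _ _ 0%N) // 1?eq_sym //; exact: (ideal0 (ideal_genP _)).
Qed.

(** * Nonzerodivisors modulo an extended ideal *)

Lemma mpoly_divX j f : exists q r,
  r \is 0.-homog for (partial_deg (pred1 j)) /\ f = 'X_j * q + r.
Proof.
rewrite [f]mpolyE; elim/big_rec: _ => [|m _ _ [q [r [hr ->]]]].
  by exists 0, 0; rewrite mulr0 addr0; split=> //; exact: dhomog0.
case: (posnP (m j)) => [mj0|mj_gt0].
  exists q, (f@_m *: 'X_[m] + r); split; last by rewrite addrCA.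
  by apply: dhomogD hr; apply: dhomogZ; rewrite dhomogX /= partial_deg1 mj0.
exists (f@_m *: 'X_[m - U_(j)] + q), r; split=> //.
rewrite mulrDr addrA -scalerAr -mpolyXD addmC submK //.
by apply/mnm_lepP => i; rewrite mnm1E; case: eqP => // <-.
Qed.

Definition nonzerodivisor_mod L u := forall f, L (u * f) -> L f.

(* Modulo 'X_j, every element of L is congruent to an element of L free of 'X_j. *)
Lemma nonzerodivisor_modX P L j : ideal L -> extended P L -> ~~ P j ->
  nonzerodivisor_mod L 'X_j.
Proof.
move=> idL extL nPj f; pose H u := u \is 0.-homog for (partial_deg (pred1 j)).
pose Q := [set u | exists h r, [/\ L h, L r, H r & u = 'X_j * h + r]].
have LQ : L `<=` Q.
  rewrite {1}(extendedE idL extL); apply: ideal_gen_sub => [|g [Lg sg]]; last first.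
    exists 0, g; rewrite mulr0 add0r; split=> //; first exact: ideal0.
    exact: supported_deg1 sg nPj.
  split.
  - by exists 0, 0; rewrite mulr0 add0r; split=> //; try exact: ideal0; exact: dhomog0.
  - move=> _ _ [h [r [Lh Lr Hr ->]]] [h' [r' [Lh' Lr' Hr' ->]]].
    exists (h + h'), (r + r'); rewrite mulrDr addrACA.
    by split=> //; [exact: idealD|exact: idealD|exact: dhomogD].
  (* Splitting a as ['X_j * q + b] leaves [b * r] as the part free of ['X_j]; all the rest carries
     the factor ['X_j]. *)
  move=> a u [h [r [Lh Lr Hr ->]]]; have [q [b [Hb ->]]] := mpoly_divX j a.
  exists (('X_j * q + b) * h + q * r), (b * r); split.
  - by apply: idealD => //; exact: idealMl.
  - exact: idealMl.
  - exact: dhomogM Hb Hr.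
  by rewrite mulrDr mulrCA [(_ + _) * r]mulrDl -['X_j * q * r]mulrA addrA -mulrDr.
move=> /LQ[h [r [Lh _ Hr fE]]].
(* Being free of ['X_j] and a multiple of it, r vanishes; then ['X_j] cancels and f = h lies in
   L. *)
have rE : r = 'X_j * (f - h) by rewrite mulrBr fE addrAC subrr add0r.
have r0 : r = 0.
  rewrite -[r](pihomog_dE Hr) rE (@pihomogM _ _ _ 1%N) //.
  by rewrite dhomogX /= partial_deg1 mnm1E eqxx.
suff -> : f = h by [].
apply/eqP; rewrite -subr_eq0; have /esym/eqP := rE; rewrite r0 mulf_eq0.
by rewrite -msupp_eq0 msuppX.
Qed.

Lemma nonzerodivisor_mod_exp L u r :
  nonzerodivisor_mod L u -> nonzerodivisor_mod L (u ^+ r).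
Proof.
move=> nzu; elim: r => [|r IHr] f; first by rewrite expr0 mul1r.
by rewrite exprS -mulrA => /nzu/IHr.
Qed.

(** All monomials share their exponent of one variable; purity in every variable leaves at most one
    monomial. *)
Definition pure j f := exists d, f \is d.-homog for (partial_deg (pred1 j)).

Lemma pure_sub j f g : {subset msupp f <= msupp g} -> pure j g -> pure j f.
Proof.
by move=> sub [d /dhomogP hg]; exists d; apply/dhomogP => m /sub/hg.
Qed.

Lemma pureP j f m m' : pure j f -> m \in msupp f -> m' \in msupp f -> m j = m' j.
Proof. by case=> d /dhomogP hf /hf + /hf; rewrite /= !partial_deg1 => -> ->. Qed.

Lemma pihomog_top_neq0 (mf : measure N) f : f != 0 ->
  exists2 d, (mmeasure mf f <= d.+1)%N & pihomog mf d f != 0.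
Proof.
rewrite -(mmeasure_poly_eq0 mf) -lt0n => lt0; exists (mmeasure mf f).-1.
  by rewrite prednK.
apply/eqP => top0; have := @mmeasureBtop _ _ mf (mmeasure mf f).-1 f.
by rewrite top0 subr0 prednK // leqnn => /(_ isT); rewrite leqNgt prednK ?leqnn.
Qed.

(* Passing to top components, one variable at a time, reduces to a monomial. *)
Lemma nonzerodivisor_mod_supported P Q L a : ideal L -> extended P L ->
  (forall j, Q j -> ~~ P j) -> supported Q a -> a != 0 -> nonzerodivisor_mod L a.
Proof.
move=> idL extL disPQ.
(* The list holds the variables in which a may fail to be pure; at first, all of them. *)
have: forall j, j \notin enum 'I_N -> pure j a by move=> j; rewrite mem_enum.
elim: (enum 'I_N) a => [|j s IHs] a pure_a supp_a nz_a.
  have lead_a := mlead_supp nz_a; set m := mlead a in lead_a.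
  have aE : a = a@_m *: 'X_[m].
    apply/mpolyP => m'; rewrite mcoeffZ mcoeffX.
    case: eqP => [<-|neq_m]; rewrite ?mulr1 // mulr0.
    apply: memN_msupp_eq0; apply/negP => m'a; apply: neq_m; apply/mnmP => i.
    exact: (pureP (pure_a i _)).
  have am_neq0 : a@_m != 0 by rewrite -mcoeff_msupp.
  move=> f; rewrite aE -scalerAl => Lf.
  have {Lf} : L ('X_[m] * f).
    by rewrite -[X in L X](scalerK am_neq0) -mul_mpolyC; exact: idealMl.
  move: f; rewrite mpolyXE_id.
  apply: (big_ind (nonzerodivisor_mod L)) => [f|u v nzu nzv f|i _ f].
  - by rewrite mul1r.
  - by rewrite -mulrA => /nzu/nzv.
  have [Qi|nQi] := boolP (Q i).
    by apply: nonzerodivisor_mod_exp; apply: nonzerodivisor_modX idL extL _; exact: disPQ.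
  by have /supportedP/(_ m lead_a i nQi) -> := supp_a; rewrite expr0 mul1r.
have IH t : {subset msupp t <= msupp a} -> pure j t -> t != 0 ->
    nonzerodivisor_mod L t.
  move=> sub_ta pure_t; apply: IHs; last exact: supported_sub supp_a.
  move=> i nsi; have [->//|neq_ij] := eqVneq i j.
  by apply: pure_sub sub_ta _; apply: pure_a; rewrite inE negb_or neq_ij.
have [Qj|nQj] := boolP (Q j); last first.
  by apply: IH => //; exists 0%N; exact: supported_deg1 nQj.
(* If [a * f] is in L, so is [t ^+ r * f] for the top component t of a in ['X_j]; as t is pure in j,
   the induction hypothesis applies to it. *)
have grL := extended_graded idL extL (disPQ j Qj).
have [d le_d nz_t] := @pihomog_top_neq0 (partial_deg (pred1 j)) a nz_a.
move=> f /(graded_top_mul grL le_d)[r]; apply: nonzerodivisor_mod_exp.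
apply: IH nz_t; first exact: msupp_pihomog.
by exists d; exact: pihomogP.
Qed.

(** * Lower bounds on degrees and the initial degree *)

Definition degree_ge (mf : measure N) e : set S :=
  [set f | forall m, m \in msupp f -> (e <= mf m)%N].

Lemma degree_ge_mul (mf : measure N) d e f g :
  degree_ge mf d f -> degree_ge mf e g -> degree_ge mf (d + e) (f * g).
Proof.
move=> df eg m /msuppM_le/allpairsP[[m1 m2] /= [m1f m2g ->]].
by rewrite mfD leq_add //; [exact: df|exact: eg].
Qed.

Lemma degree_ge_ideal (mf : measure N) e : ideal (degree_ge mf e).
Proof.
split=> [m|f g ef eg m|a f ef].
- by rewrite msupp0.
- by move/msuppD_le; rewrite mem_cat => /orP[/ef|/eg].
- by rewrite -[e]add0n; exact: degree_ge_mul.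
Qed.

Lemma degree_ge_exp (mf : measure N) e J k : J `<=` degree_ge mf e ->
  ideal_exp J k `<=` degree_ge mf (e * k).
Proof.
move=> Je; elim: k => [|k IHk]; first by rewrite muln0.
apply: ideal_mul_sub => [|x y /Je ex /IHk ey]; first exact: degree_ge_ideal.
by rewrite mulnS; exact: degree_ge_mul.
Qed.

Lemma least_eq (D : set nat) d : D d -> (forall e, D e -> (d <= e)%N) -> least D = d.
Proof.
move=> Dd ledD; apply: xget_subset1 => // e e' [De lee] [De' lee'].
by apply/eqP; rewrite eqn_leq lee // lee'.
Qed.

Lemma exists_minimum (D : set nat) : D !=set0 ->
  exists2 d, D d & forall e, D e -> (d <= e)%N.
Proof.
case=> d0 Dd0; have exD : exists d, `[< D d >] by exists d0; exact/asboolP.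
by case: (ex_minnP exD) => d /asboolP Dd led; exists d => // e /asboolP/led.
Qed.

(** J is generated by forms in the variables of P, for which total and partial degree agree. If e is
    the least degree of a nonzero one, no element of J has a monomial of degree below e, and mJ
    starts in degree e + 1; so e is the initial degree. *)
Lemma alpha_spec P J : homogeneous_ideal J -> extended P J -> J <> [set 0] ->
  J `<=` degree_ge (partial_deg P) (alpha J) /\
  exists h, [/\ J h, supported P h, h != 0 & h \is (alpha J).-homog].
Proof.
move=> [idJ grJ] extJ J_neq0.
pose D := [set d | exists h, [/\ J h, supported P h, h != 0 & h \is d.-homog]].
have mdeg_supp g m : supported P g -> m \in msupp g -> mdeg m = partial_deg P m.
  move/supportedP => suppg /suppg m0.
  by rewrite mdegE (bigID P) /= [X in (_ + X)%N]big1 ?addn0.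
have compD g m : J g -> supported P g -> m \in msupp g -> D (mdeg m).
  move=> Jg sg mg; exists (pihomog mdeg (mdeg m) g); split; first exact: grJ.
  - by apply: supported_sub sg; exact: msupp_pihomog.
  - apply/eqP => g0; have := mcoeff_pihomog mdeg (mdeg m) g m.
    by rewrite g0 mcoeff0 eqxx => /esym/eqP; rewrite mcoeff_eq0 mg.
  - exact: pihomogP.
have [e [h [Jh sh nz_h hh]] leD] : exists2 d, D d & forall e, D e -> (d <= e)%N.
  apply: exists_minimum; apply: contrapT => D0; apply: J_neq0.
  apply/seteqP; split=> [f /extJ Jf|_ ->]; last exact: ideal0.
  have id0 : ideal [set 0 : S].
    by split=> [|x y -> ->|a x ->] //=; rewrite ?addr0 ?mulr0.
  apply: (ideal_gen_sub id0) Jf => g [Jg sg] /=; apply: contrapT => /eqP nz_g.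
  by apply: D0; exists (mdeg (mlead g)); exact: compD Jg sg (mlead_supp nz_g).
have geJ : J `<=` degree_ge (partial_deg P) e.
  move=> f /extJ; apply: ideal_gen_sub; first exact: degree_ge_ideal.
  move=> g [Jg sg] m mg; rewrite /= -(mdeg_supp g) //.
  exact: leD _ (compD _ _ Jg sg mg).
have geJ' : J `<=` degree_ge mdeg e.
  by move=> f /geJ fe m /fe /leq_trans; apply; exact: partial_deg_le.
suff -> : alpha J = e by split=> //; exists h.
have ge_of d f : f != 0 -> J f -> f \is d.-homog -> (e <= d)%N.
  move=> nz_f /geJ' fe /dhomogP hf; rewrite -(hf _ (mlead_supp nz_f)).
  exact: fe (mlead_supp nz_f).
apply: least_eq => [|d [f [hf Jf nf]]]; last first.
  (* The zero form lies in mJ, so a candidate for [alpha] is nonzero. *)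
  apply: ge_of Jf hf; apply/eqP => f0; apply: nf; rewrite f0.
  by apply: ideal0; exact: ideal_mulP.
exists h; split=> // hm.
have mge1 : graded_max_ideal (K := K) (n := N) `<=` degree_ge mdeg 1.
  apply: ideal_gen_sub; first exact: degree_ge_ideal.
  by move=> _ [i _ <-] m; rewrite msuppX inE => /eqP ->; rewrite /= mdeg1.
have : degree_ge mdeg e.+1 h.
  apply: ideal_mul_sub hm; first exact: degree_ge_ideal.
  by move=> x y /mge1 x1 /geJ' ye; rewrite -add1n; exact: degree_ge_mul.
move=> /(_ _ (mlead_supp nz_h)).
by have /dhomogP/(_ _ (mlead_supp nz_h)) /= -> := hh; rewrite ltnn.
Qed.

(** * Associated primes and v-numbers of powers of a product *)

Lemma mpolyX_divide d (c : 'X_{1..N}) f : f \is d.-homog ->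
    (forall m, m \in msupp f -> (c <= m)%MM) ->
  exists2 s, f = 'X_[c] * s & s \is (d - mdeg c).-homog.
Proof.
move=> /dhomogP hf cf; exists (\sum_(m <- msupp f) f@_m *: 'X_[m - c]).
  rewrite [LHS]mpolyE mulr_sumr big_seq [RHS]big_seq; apply: eq_bigr => m mf.
  by rewrite -scalerAr -mpolyXD addmC submK // cf.
rewrite big_seq; apply: rpred_sum => m mf; apply: rpredZ; rewrite dhomogX.
have /(congr1 mdeg) := submK (cf m mf); rewrite mdegD => mE.
by rewrite -(hf m mf) /= -mE addnK.
Qed.

(** Apply [graded_prime_component] to the variables outside P one after another. Supports only
    shrink, which preserves the purity already gained and the degrees of f. *)
Lemma prime_colon_pure P L p f : ideal L -> extended P L -> prime_ideal p ->
    colon L f = p ->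
  exists g, [/\ colon L g = p, {subset msupp g <= msupp f}
    & forall j, ~~ P j -> pure j g].
Proof.
move=> idL extL prp pE.
suff [g [gE sub_gf pure_g]] : exists g, [/\ colon L g = p,
    {subset msupp g <= msupp f} & forall j, j \in enum 'I_N -> ~~ P j -> pure j g].
  by exists g; split=> // j; apply: pure_g; rewrite mem_enum.
elim: (enum 'I_N) => [|j s [g [gE sub_gf pure_g]]].
  by exists f; split.
have [Pj|nPj] := boolP (P j).
  by exists g; split=> // i; rewrite inE => /predU1P[->|/pure_g //]; rewrite Pj.
have [e eE] := graded_prime_component (extended_graded idL extL nPj) prp gE.
exists (pihomog (partial_deg (pred1 j)) e g); split=> //.
  by move=> m /msupp_pihomog/sub_gf.
move=> i; rewrite inE => /predU1P[-> _|si nPi].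
  by exists e; exact: pihomogP.
by apply: pure_sub (pure_g i si nPi); exact: msupp_pihomog.
Qed.

Lemma supported_exp P f k : supported P f -> supported P (f ^+ k).
Proof. by move/(dhomogMn k). Qed.

(** Stated for two complementary blocks of variables, so that both halves of the theorem are
    instances. *)
Lemma vnumber_exp_mul P Q I J k p : (forall j, Q j = ~~ P j) ->
    homogeneous_ideal I -> extended P I -> I <> [set 0] ->
    homogeneous_ideal J -> extended Q J -> J <> [set 0] ->
    Ass (ideal_exp I k) p ->
  vnumber p (ideal_exp (ideal_mul I J) k)
    = (vnumber p (ideal_exp I k) + alpha J * k)%N.
Proof.
move=> QE homI extI I_neq0 homJ extJ J_neq0 [prp [f0 f0E]].
have [geJ [h [Jh supp_h nz_h homh]]] := alpha_spec homJ extJ J_neq0.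
have [_ [u [Iu supp_u nz_u _]]] := alpha_spec homI extI I_neq0.
set A := ideal_exp I k in f0E *; set C := ideal_exp _ k; pose B := ideal_exp J k.
have [idI _] := homI; have [idJ _] := homJ.
have idA : ideal A := ideal_expP I k.
have idB : ideal B := ideal_expP J k.
have CA : C `<=` A := ideal_expS (ideal_mul_subl idI).
have CB : C `<=` B := ideal_expS (ideal_mul_subr idJ).
have extA : extended P A := extended_exp idI extI.
have extB : extended Q B := extended_exp idJ extJ.
have Bt : B (h ^+ k) := mem_ideal_exp k Jh.
have supp_t := supported_exp k supp_h.
have nz_t : h ^+ k != 0 by rewrite expf_neq0.
have nzdA a : supported Q a -> a != 0 -> nonzerodivisor_mod A a.
  by apply: (nonzerodivisor_mod_supported idA extA) => j; rewrite QE.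
have nzdB a : supported P a -> a != 0 -> nonzerodivisor_mod B a.
  by apply: (nonzerodivisor_mod_supported idB extB) => j; rewrite QE negbK.
have [idp p1 pM] := prp.
(* Otherwise [h ^+ k * f0] is in A; cancelling [h ^+ k] modulo A puts f0 in A and 1 in p. *)
have npt : ~ p (h ^+ k).
  rewrite -f0E => /(nzdA _ supp_t nz_t) Af0; apply: p1.
  by rewrite -f0E /colon /= mul1r.
(* Some homogeneous component of f0 still has colon ideal p, so [least] takes a true minimum. *)
have [d [f [homf fE]] led] : exists2 d, (exists f, f \is d.-homog /\ colon A f = p)
    & forall e, (exists f, f \is e.-homog /\ colon A f = p) -> (d <= e)%N.
  apply: exists_minimum.
  have [e eE] := graded_prime_component (graded_exp k homI) prp f0E.
  by exists e, (pihomog mdeg e f0); split=> //; exact: pihomogP.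
have -> : vnumber p A = d by apply: least_eq => //; exists f.
apply: least_eq => [|e [g [homg gE]]].
  exists (f * h ^+ k); split; first by apply: dhomogM => //; exact: dhomogMn.
  apply/seteqP; split=> x; last first.
    by rewrite -fE /colon /= mulrA => Axf; exact: mem_ideal_exp_mul.
  move=> /CA; rewrite /= mulrA mulrAC => Axhf; have : p (x * h ^+ k) by rewrite -fE.
  by move/pM=> [].
have gAE : colon A g = p.
  apply/seteqP; split=> x; last by rewrite -gE => /CA.
  move=> Axg; suff /pM[] : p (x * h ^+ k) by [].
  by rewrite -gE /colon /= mulrAC; exact: mem_ideal_exp_mul.
(* The power [u ^+ k] lies in A, hence in p = (C : g), so [u ^+ k * g] is in C and thus in B;
   [u ^+ k] cancels modulo B. *)
have Bg : B g.
  apply: (nzdB (u ^+ k)); [exact: supported_exp|by rewrite expf_neq0|].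
  apply: CB; have : p (u ^+ k); last by rewrite -gE.
  by rewrite -gAE; apply: idealMr => //; exact: mem_ideal_exp.
have [v [vE sub_vg pure_v]] := prime_colon_pure idA extA prp gAE.
have nz_v : v != 0.
  apply/eqP => v0; apply: p1; rewrite -vE v0 /colon /= mulr0; exact: ideal0.
have lead_v := mlead_supp nz_v; set m0 := mlead v in lead_v.
(* By purity all monomials of v have the same exponents outside P; c records them, read off from the
   leading one. *)
pose c := [multinom (if P i then 0 else m0 i)%N | i < N].
have mdegc : mdeg c = partial_deg Q m0.
  rewrite mdegE /partial_deg [RHS]big_mkcond /=; apply: eq_bigr => i _.
  by rewrite mnmE QE; case: (P i).
have homv : v \is e.-homog.
  by apply/dhomogP => m /sub_vg; move/dhomogP: homg; apply.
have cv m : m \in msupp v -> (c <= m)%MM.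
  move=> mv; apply/mnm_lepP => i; rewrite mnmE; case: ifPn => // nPi.
  by rewrite (pureP (pure_v i nPi) lead_v mv).
have [s vs homs] := mpolyX_divide homv cv.
(* The monomial ['X_[c]] is a nonzerodivisor modulo A, so dividing v by it keeps the colon ideal. *)
have sE : colon A s = p.
  have supp_c : supported Q ('X_[c] : S).
    by apply/supportedP => m /mem_msuppXP <- i; rewrite QE negbK mnmE => ->.
  have nz_c : 'X_[c] != 0 :> S by rewrite -msupp_eq0 msuppX.
  rewrite -vE vs; apply/seteqP; split=> x; rewrite /colon /= mulrCA.
    by move=> Axs; exact: idealMl.
  exact: nzdA.
have := led _ (ex_intro _ s (conj homs sE)).
(* This keeps the truncated subtraction in d <= e - mdeg c honest, so that mdeg c can be moved
   across. *)
have le_ce : (mdeg c <= e)%N.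
  have /dhomogP/(_ _ lead_v) <- := homv; rewrite mdegc; exact: partial_deg_le.
have le_c : (alpha J * k <= mdeg c)%N.
  by rewrite mdegc; apply: (degree_ge_exp geJ Bg); exact: sub_vg.
by move=> le_d; rewrite -(subnK le_ce); exact: leq_add le_d le_c.
Qed.

End Supports.

(** * Inclusions of polynomial rings *)

Section VariableInclusion.
Variables (K : fieldType) (n N : nat) (sigma : 'I_n -> 'I_N).

(** Common form of [inclR] and [inclT], which are the cases of [lshift] and [rshift]. *)
Definition var_incl : {mpoly K[n]} -> {mpoly K[N]} :=
  comp_mpoly [tuple 'X_(sigma i) | i < n].

HB.instance Definition _ := GRing.RMorphism.on var_incl.

Lemma var_incl_inj : injective sigma -> injective var_incl.
Proof.
move=> sigma_inj.
(* Left inverse: variables in the image of sigma go back, the others go to 0. *)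
pose back := comp_mpoly
  [tuple (if [pick i | sigma i == j] is Some i then 'X_i else 0) | j < N]
  : {mpoly K[N]} -> {mpoly K[n]}.
apply: (can_inj (g := back)) => f; rewrite [RHS]mpolyE /var_incl comp_mpolyE /back.
rewrite raddf_sum; apply: eq_bigr => m _ /=; rewrite linearZ /= rmorph_prod /=.
rewrite mpolyXE_id; congr (_ *: _); apply: eq_bigr => i _.
rewrite rmorphXn /= tnth_mktuple comp_mpolyXU -tnth_nth tnth_mktuple.
case: pickP => [i' /eqP/sigma_inj -> //|/(_ i)]; by rewrite eqxx.
Qed.

Definition in_image : pred 'I_N := [pred j | [exists i, sigma i == j]].

Lemma var_incl_monomial (m : 'X_{1..n}) :
  exists2 m' : 'X_{1..N}, var_incl 'X_[m] = 'X_[m'] &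
    mdeg m' = mdeg m /\ partial_deg (predC in_image) m' = 0%N.
Proof.
exists (\sum_i U_(sigma i) *+ m i)%MM.
  rewrite /var_incl comp_mpolyX (big_morph _ (@mpolyXD _ _) (@mpolyX0 _ _)).
  apply: eq_bigr => i _.
  by rewrite tnth_mktuple mpolyXn.
split.
  by rewrite mdeg_sum mdegE; apply: eq_bigr => i _; rewrite mdegMn mdeg1 mul1n.
apply/eqP; rewrite sum_nat_eq0; apply/forall_inP => j nj.
rewrite mnm_sumE big1 // => i _; rewrite mulmnE mnm1E; case: eqP => // ij.
by case/negP: nj; apply/existsP; exists i; rewrite ij.
Qed.

Lemma var_incl_homog d f : f \is d.-homog -> var_incl f \is d.-homog.
Proof.
move=> /dhomogP hf; rewrite /var_incl comp_mpolyEX big_seq.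
apply: rpred_sum => m mf; apply: rpredZ; rewrite -/(var_incl _).
by have [m' -> [mE _]] := var_incl_monomial m; rewrite dhomogX /= mE hf.
Qed.

Lemma var_incl_supported f : supported in_image (var_incl f).
Proof.
rewrite /supported /var_incl comp_mpolyEX.
apply: rpred_sum => m _; apply: rpredZ; rewrite -/(var_incl _).
by have [m' -> [_ mE]] := var_incl_monomial m; rewrite dhomogX /= mE.
Qed.

Lemma pihomog_var_incl d f :
  pihomog mdeg d (var_incl f) = var_incl (pihomog mdeg d f).
Proof.
rewrite [in LHS](pihomog_partitionE (leq_maxl (mmeasure mdeg f) d.+1)).
have homf i : var_incl (pihomog mdeg i f) \is i.-homog.
  by apply: var_incl_homog; exact: pihomogP.
have lt_d : (d < maxn (mmeasure mdeg f) d.+1)%N by rewrite leq_maxr.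
rewrite (raddf_sum var_incl) (raddf_sum (pihomog mdeg d)).
rewrite (bigD1 (Ordinal lt_d)) //= (pihomog_dE (homf d)) big1 ?addr0 // => i neq_i.
by apply: pihomog_ne0 (homf i).
Qed.

Lemma ideal_ext_var_incl_homogeneous (I : set {mpoly K[n]}) :
  homogeneous_ideal I -> homogeneous_ideal (ideal_ext var_incl I).
Proof.
move=> [idI grI]; apply: graded_gen => d _ [f If <-].
by apply: sub_ideal_gen; exists (pihomog mdeg d f);
  rewrite ?pihomog_var_incl //; exact: grI.
Qed.

Lemma ideal_ext_var_incl_extended (I : set {mpoly K[n]}) :
  extended in_image (ideal_ext var_incl I).
Proof.
apply: ideal_gen_sub => [|_ [f If <-]]; first exact: ideal_genP.
apply: sub_ideal_gen; split; last exact: var_incl_supported.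
by apply: sub_ideal_gen; exists f.
Qed.

Lemma ideal_ext_var_incl_neq0 (I : set {mpoly K[n]}) :
  injective sigma -> ideal I -> I <> [set 0] -> ideal_ext var_incl I <> [set 0].
Proof.
move=> sigma_inj idI I_neq0 ext0; apply: I_neq0; apply/seteqP; split=> [f If|_ ->].
  have : ideal_ext var_incl I (var_incl f) by apply: sub_ideal_gen; exists f.
  by rewrite ext0 /= => f0; apply: (var_incl_inj sigma_inj); rewrite f0 raddf0.
exact: ideal0.
Qed.

End VariableInclusion.

(** * The two blocks of variables and the theorem *)

Lemma in_image_rshift n m j :
  in_image (@rshift n m) j = ~~ in_image (@lshift n m) j.
Proof.
apply/idP/idP => [/existsP[i /eqP <-]|/existsPn nl].
  by apply/existsPn => i'; rewrite eq_lrshift.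
apply/existsP; case: (split_ordP j) => i jE; last by exists i; rewrite jE.
by have := nl i; rewrite jE eqxx.
Qed.

Theorem theorem2p2 (K : fieldType) (n m : nat)
    (I : set {mpoly K[n]}) (J : set {mpoly K[m]})
    (homI : homogeneous_ideal I) (propI : I <> setT) (I_neq0 : I <> [set 0])
    (homJ : homogeneous_ideal J) (propJ : J <> setT) (J_neq0 : J <> [set 0]) :
  let IS : set {mpoly K[n + m]} := ideal_ext (@inclR K n m) I in
  let JS : set {mpoly K[n + m]} := ideal_ext (@inclT K n m) J in
  (forall (k : nat) (p : set {mpoly K[n + m]}),
      (1 <= k)%N -> Ass (ideal_exp IS k) p ->
      vnumber p (ideal_exp (ideal_mul IS JS) k)
        = (vnumber p (ideal_exp IS k) + alpha JS * k)%N)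
  /\
  (forall (k : nat) (q : set {mpoly K[n + m]}),
      (1 <= k)%N -> Ass (ideal_exp JS k) q ->
      vnumber q (ideal_exp (ideal_mul IS JS) k)
        = (vnumber q (ideal_exp JS k) + alpha IS * k)%N).
Proof.
move=> IS JS.
have homIS : homogeneous_ideal IS :=
  ideal_ext_var_incl_homogeneous (@lshift n m) homI.
have homJS : homogeneous_ideal JS :=
  ideal_ext_var_incl_homogeneous (@rshift n m) homJ.
have extIS := @ideal_ext_var_incl_extended K _ _ (@lshift n m) I : extended _ IS.
have extJS := @ideal_ext_var_incl_extended K _ _ (@rshift n m) J : extended _ JS.
have IS_neq0 : IS <> [set 0] :=
  ideal_ext_var_incl_neq0 (@lshift_inj n m) homI.1 I_neq0.
have JS_neq0 : JS <> [set 0] :=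
  ideal_ext_var_incl_neq0 (@rshift_inj n m) homJ.1 J_neq0.
split=> k p _.
  exact: (vnumber_exp_mul (@in_image_rshift n m)
    homIS extIS IS_neq0 homJS extJS JS_neq0).
(* The second half is the first with the roles of I and J exchanged. *)
rewrite ideal_mulC.
apply: (vnumber_exp_mul _ homJS extJS JS_neq0 homIS extIS IS_neq0) => j.
by rewrite in_image_rshift negbK.
Qed.
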